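(* Let $\{P_n\}_{n\ge0}$ be a semiclassical monic orthogonal polynomial sequence, with $\Phi,C_n,D_n,\gamma_{n+1},H_1,H_2,M_{0,1},M_{0,2},M_{1,2}$ as in the context. Then for every $n\ge0$, $$\mathcal{C}_{2}(x;n)P_{n+1}''(x)+\mathcal{D}_{2}(x;n)P_{n+1}'(x)+\mathcal{E}_{2}(x;n)P_{n+1}(x)=0$$ holds with each of the following two choices of coefficients (arguments omitted): (I) $\mathcal C_2=\Phi^2H_1$, $\ \mathcal D_2=M_{1,2}H_1-\Phi H_2$, $\ \mathcal E_2=M_{0,2}H_1-M_{0,1}H_2$; (II) $\mathcal C_2=\Phi^2D_{n+1}$, $\ \mathcal D_2=\Phi\big[(\Phi'+C_0)D_{n+1}-\Phi D_{n+1}'\big]$, $$\mathcal E_2=D_{n+1}\Big[\gamma_{n+1}D_nD_{n+1}-\tfrac14\big(C_{n+1}^2-C_0^2\big)-\tfrac12\Phi\big(C_{n+1}'-C_0'\big)\Big]+\tfrac12\big(C_{n+1}-C_0\big)\Phi D_{n+1}'.$$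
   Context: A form $u$ is a linear functional on the space of complex polynomials, with moments $(u)_n=\langle u,x^n\rangle$. It is regular, with monic orthogonal polynomial sequence (MOPS) $\{P_n\}_{n\ge0}$, if $P_n$ is monic of degree $n$ and $\langle u,P_nP_m\rangle=r_n\delta_{n,m}$ with all $r_n\neq0$. Forms are normalized: $(u)_0=1$. A MOPS satisfies $P_0=1$, $P_1=x-\beta_0$, $P_{n+2}=(x-\beta_{n+1})P_{n+1}-\gamma_{n+1}P_n$ ($n\ge0$), with $\beta_n\in\mathbb C$, $\gamma_{n+1}\in\mathbb C\setminus\{0\}$. The formal Stieltjes function of $u$ is $S(u)(z)=-\sum_{n\ge0}(u)_n z^{-n-1}$. The regular form $u$ (and its MOPS) is semiclassical if there are polynomials $\Phi,C,D$, with $\Phi$ monic (in particular nonzero), such that, as formal series in $1/z$, $\Phi(z)S'(u)(z)=C(z)S(u)(z)+D(z)$. Fix such polynomials. Define polynomials $C_n,D_n$ by $C_0=C$, $D_0=D$, $D_{-1}=0$, $\gamma_0=1$, and for $n\ge0$: $C_{n+1}(x)=-C_n(x)+2(x-\beta_n)D_n(x)$, $\gamma_{n+1}D_{n+1}(x)=-\Phi(x)+\gamma_nD_{n-1}(x)-(x-\beta_n)C_n(x)+(x-\beta_n)^2D_n(x)$. For $n\ge0$ (arguments omitted, primes are $d/dx$): $H_1=-\gamma_{n+1}D_{n+1}$, $H_2=\gamma_{n+1}\{\tfrac12(C_{n+1}+C_0)D_{n+1}-\Phi D_{n+1}'\}$, $M_{0,1}=-\tfrac12(C_{n+1}-C_0)$,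 $M_{1,2}=\Phi(\Phi'+M_{0,1})$, $M_{0,2}=\Phi M_{0,1}'+\gamma_{n+1}D_nD_{n+1}$. *)

(* Defs.v *)
From HB Require Import structures.
From mathcomp Require Import all_boot all_order all_algebra.
From mathcomp Require Import reals.
From mathcomp Require Export complex.

Set Implicit Arguments.
Unset Strict Implicit.
Unset Printing Implicit Defensive.

Import Order.TTheory GRing.Theory Num.Theory.

Local Open Scope ring_scope.
Local Open Scope complex_scope.

(** The complex numbers are [R[i]] for [R : realType], a model of the reals. *)

Section Forms.
Context {R : realType}.

Definition linform := {scalar {poly R[i]}}.

Definition moment (u : linform) (n : nat) : R[i] := u 'X^n.

Definition normalized (u : linform) : Prop := moment u 0%N = 1.

Definition is_MOPS (u : linform) (P : nat -> {poly R[i]}) : Prop :=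
  (forall n, P n \is monic /\ size (P n) = n.+1) /\
  exists r : nat -> R[i],
    (forall n, r n != 0) /\
    (forall n m, u (P n * P m) = if n == m then r n else 0).

(** [P] determines [beta] and all [gamma n.+1]; [gamma 0 = 1] is only the
    convention used in the definition of the polynomials D_n. *)
Definition recurrence_coefs (P : nat -> {poly R[i]}) (beta gamma : nat -> R[i])
    : Prop :=
  [/\ P 0%N = 1,
      P 1%N = 'X - (beta 0%N)%:P,
      forall n, P n.+2 = ('X - (beta n.+1)%:P) * P n.+1 - gamma n.+1 *: P n,
      forall n, gamma n.+1 != 0
    & gamma 0%N = 1].

End Forms.

Section FormalSeries.
Context {R : realType}.

(** [s k] is the coefficient of z^k, [k : int].  A formal series in 1/z, possibly
    multiplied by a polynomial, has [s k = 0] for all large [k]; the operations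
    below do not need this, since one factor of the product is a polynomial. *)
Definition fseries := int -> R[i].

Definition fseries_of_poly (p : {poly R[i]}) : fseries :=
  fun k => if k is Posz n then p`_n else 0.

Definition fseries_add (s t : fseries) : fseries := fun k => s k + t k.

Definition fseries_polymul (p : {poly R[i]}) (s : fseries) : fseries :=
  fun k => \sum_(i < size p) p`_i * s (k - i%:Z).

Definition fseries_deriv (s : fseries) : fseries :=
  fun k => (k + 1)%:~R * s (k + 1).

(** [Negz n] is the integer -(n+1). *)
Definition stieltjes (u : linform) : fseries :=
  fun k => if k is Negz n then - moment u n else 0.

Definition semiclassical_with (u : linform) (Phi C D : {poly R[i]}) : Prop :=
  Phi \is monic /\
  fseries_polymul Phi (fseries_deriv (stieltjes u)) =1
  fseries_add (fseries_polymul C (stieltjes u)) (fseries_of_poly D).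

End FormalSeries.

Section Coefficients.
Context {R : realType}.
Implicit Types (beta gamma : nat -> R[i]) (Phi C D : {poly R[i]}).

(** The triple (C_n, D_n, D_{n-1}), with D_{-1} = 0. *)
Fixpoint CDD beta gamma Phi C D (n : nat)
    : {poly R[i]} * {poly R[i]} * {poly R[i]} :=
  if n is m.+1 then
    let: (Cm, Dm, Dm1) := CDD beta gamma Phi C D m in
    let x := 'X - (beta m)%:P in
    (- Cm + 2 * x * Dm,
     (gamma m.+1)^-1 *: (- Phi + gamma m *: Dm1 - x * Cm + x ^+ 2 * Dm),
     Dm)
  else (C, D, 0).

Definition Cseq beta gamma Phi C D n := (CDD beta gamma Phi C D n).1.1.
Definition Dseq beta gamma Phi C D n := (CDD beta gamma Phi C D n).1.2.

Lemma CseqS beta gamma Phi C D n :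
  let Cn := Cseq beta gamma Phi C D in let Dn := Dseq beta gamma Phi C D in
  Cn n.+1 = - Cn n + 2 * ('X - (beta n)%:P) * Dn n.
Proof. by rewrite /Cseq /Dseq /=; case: (CDD _ _ _ _ _ n) => [[]]. Qed.

Lemma DseqS beta gamma Phi C D n : gamma n.+1 != 0 ->
  let Cn := Cseq beta gamma Phi C D in let Dn := Dseq beta gamma Phi C D in
  gamma n.+1 *: Dn n.+1 =
    - Phi + gamma n *: (if n is m.+1 then Dn m else 0)
    - ('X - (beta n)%:P) * Cn n + ('X - (beta n)%:P) ^+ 2 * Dn n.
Proof.
move=> gn0 /=; have -> : (if n is m.+1 then Dseq beta gamma Phi C D m else 0)
    = (CDD beta gamma Phi C D n).2.
  by case: n {gn0} => //= m; rewrite /Dseq; case: (CDD _ _ _ _ _ m) => [[]].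
rewrite /Cseq /Dseq /=; case: (CDD _ _ _ _ _ n) => [[c d] d'] /=.
by rewrite scalerA divff // scale1r.
Qed.

(** Below, [Cs] and [Ds] are the sequences (C_n) and (D_n). *)
Implicit Types (Cs Ds : nat -> {poly R[i]}) (n : nat).

Definition H1 gamma Ds n : {poly R[i]} := - (gamma n.+1 *: Ds n.+1).

Definition H2 gamma Phi Cs Ds n : {poly R[i]} :=
  gamma n.+1 *:
    (2^-1 *: (Cs n.+1 + Cs 0%N) * Ds n.+1 - Phi * (Ds n.+1)^`()).

Definition M01 Cs n : {poly R[i]} := - (2^-1 *: (Cs n.+1 - Cs 0%N)).

Definition M12 Phi Cs n : {poly R[i]} := Phi * (Phi^`() + M01 Cs n).

Definition M02 gamma Phi Cs Ds n : {poly R[i]} :=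
  Phi * (M01 Cs n)^`() + gamma n.+1 *: (Ds n * Ds n.+1).

Definition ode2 (C2 D2 E2 p : {poly R[i]}) : Prop :=
  C2 * p^`(2) + D2 * p^`() + E2 * p = 0.

End Coefficients.

(* Main.v *)
(** Differentiating the three-term recurrence and substituting the recursions for
    C_n and D_n gives, by induction on n, the structure relation
      Phi P_(n+1)' = 1/2 (C_(n+1) - C_0) P_(n+1) - gamma_(n+1) D_(n+1) P_n
    and its companion
      Phi P_n' = - 1/2 (C_(n+1) + C_0) P_n + D_n P_(n+1).
    Writing the first one as Phi P_(n+1)' + M_(0,1) P_(n+1) = H_1 P_n,
    differentiating it and eliminating P_n' with the second one gives
      Phi^2 P_(n+1)'' + M_(1,2) P_(n+1)' + M_(0,2) P_(n+1) = H_2 P_n.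
    Eliminating P_n between the last two is (I), and dividing (I) by
    - gamma_(n+1) is (II). *)

Require Import Defs.
From mathcomp Require Import all_boot all_order all_algebra.
From mathcomp Require Import reals complex.
From mathcomp Require Import ring.

Import GRing.Theory Num.Theory.

Local Open Scope ring_scope.
Local Open Scope complex_scope.

Lemma halfD_self (R : realType) (p : {poly R[i]}) : 2^-1 *: (p + p) = p.
Proof. by rewrite -mulr2n -[p *+ 2]scaler_nat scalerA mulVf ?scale1r ?pnatr_eq0. Qed.

(** Both relations go through one induction: the second at [n.+1] is the first at [n] with [P n]
    eliminated by the recurrence, and the first at [n.+1] needs both at [n]. *)
Lemma structure_relations (R : realType) (P : nat -> {poly R[i]})
    (beta gamma : nat -> R[i]) (Phi C D : {poly R[i]}) :
  recurrence_coefs P beta gamma ->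
  let Cs := Cseq beta gamma Phi C D in
  let Ds := Dseq beta gamma Phi C D in
  forall n,
    Phi * (P n.+1)^`() = 2^-1 *: (Cs n.+1 - Cs 0%N) * P n.+1
                         - gamma n.+1 *: (Ds n.+1 * P n)
    /\ Phi * (P n)^`() = Ds n * P n.+1 - 2^-1 *: (Cs n.+1 + Cs 0%N) * P n.
Proof.
case=> P0 P1 PSS gamma_neq0 gamma0 Cs Ds.
have CS n : Cs n.+1 = - Cs n + 2 * ('X - (beta n)%:P) * Ds n by exact: CseqS.
have DS n := DseqS beta Phi C D (gamma_neq0 n); rewrite /= -/Cs -/Ds in DS.
(* [Cs n] enters its recursion with a minus sign, so passing from [n] to [n.+1] exchanges the
   half-difference and the half-sum with [Cs 0]. *)
have subC n : 2^-1 *: (Cs n.+1 - Cs 0%N)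
    = ('X - (beta n)%:P) * Ds n - 2^-1 *: (Cs n + Cs 0%N).
  rewrite -[X in _ = X - _]halfD_self -scalerBr CS; congr (_ *: _); ring.
have addC n : 2^-1 *: (Cs n.+1 + Cs 0%N)
    = ('X - (beta n)%:P) * Ds n - 2^-1 *: (Cs n - Cs 0%N).
  rewrite -[X in _ = X - _]halfD_self -scalerBr CS; congr (_ *: _); ring.
elim=> [|n [IH1 IH2]].
  (* At [n = 0] the first relation is the recursion for [Ds 1], whose D_(-1) term vanishes; both
     sides of the second are zero. *)
  have dP0 : (P 0%N)^`() = 0 by rewrite P0 -[1]/(1%:P) derivC.
  rewrite subC addC halfD_self subrr scaler0 scalerAl DS dP0 P0 P1.
  by rewrite derivB derivX derivC scaler0; split; ring.
(* With everything in terms of half-sums and half-differences, [ring] never has to cancel 2 against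
   the constant polynomial 1/2. *)
have C_halves : Cs n.+1 = 2^-1 *: (Cs n.+1 - Cs 0%N) + 2^-1 *: (Cs n.+1 + Cs 0%N).
  by rewrite -scalerDr addrACA addNr addr0 halfD_self.
have IH1' : Phi * (P n.+1)^`() = Ds n.+1 * P n.+2
    - 2^-1 *: (Cs n.+2 + Cs 0%N) * P n.+1.
  rewrite IH1 PSS (addC n.+1) -!mul_polyC; ring.
split=> //.
have -> : Phi * (P n.+2)^`() = Phi * P n.+1
    + ('X - (beta n.+1)%:P) * (Phi * (P n.+1)^`())
    - gamma n.+1 *: (Phi * (P n)^`()).
  by rewrite PSS derivB derivM derivB derivX derivC derivZ -!mul_polyC; ring.
have DSS := DS n.+1; rewrite [Cs n.+1]C_halves in DSS.
rewrite IH1 IH2 [gamma n.+2 *: _]scalerAl DSS PSS (subC n.+1) -!mul_polyC.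
ring.
Qed.

Lemma second_order_relation (R : realType) (P : nat -> {poly R[i]})
    (beta gamma : nat -> R[i]) (Phi C D : {poly R[i]}) (n : nat) :
  recurrence_coefs P beta gamma ->
  let Cs := Cseq beta gamma Phi C D in
  let Ds := Dseq beta gamma Phi C D in
  Phi ^+ 2 * (P n.+1)^`(2) + M12 Phi Cs n * (P n.+1)^`()
    + M02 gamma Phi Cs Ds n * P n.+1 = H2 gamma Phi Cs Ds n * P n.
Proof.
move=> hrec Cs Ds.
have [str1 str2] := structure_relations R P beta gamma Phi C D hrec n.
rewrite -/Cs -/Ds in str1 str2.
rewrite /M12 /M02 /H2 /M01 derivSn derivn1 derivN.
have -> : Phi ^+ 2 * ((P n.+1)^`())^`()
    = Phi * (Phi * (P n.+1)^`())^`() - Phi * Phi^`() * (P n.+1)^`().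
  by rewrite derivM; ring.
rewrite str1 derivB derivM !derivZ derivM -!mul_polyC.
move: str2; rewrite -!mul_polyC => str2.
ring: str2.
Qed.

Theorem corollary2 (R : realType) (u : {scalar {poly R[i]}}) (P : nat -> {poly R[i]})
    (beta gamma : nat -> R[i]) (Phi C D : {poly R[i]})
    (hu : normalized u) (hP : is_MOPS u P)
    (hrec : recurrence_coefs P beta gamma)
    (hS : semiclassical_with u Phi C D) (n : nat) :
  let Cs := Cseq beta gamma Phi C D in
  let Ds := Dseq beta gamma Phi C D in
  let h1 := H1 gamma Ds n in
  let h2 := H2 gamma Phi Cs Ds n in
  let m01 := M01 Cs n in
  let m12 := M12 Phi Cs n in
  let m02 := M02 gamma Phi Cs Ds n in
  ode2 (Phi ^+ 2 * h1)
       (m12 * h1 - Phi * h2)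
       (m02 * h1 - m01 * h2)
       (P n.+1)
  /\
  ode2 (Phi ^+ 2 * Ds n.+1)
       (Phi * ((Phi^`() + Cs 0%N) * Ds n.+1 - Phi * (Ds n.+1)^`()))
       (Ds n.+1 * (gamma n.+1 *: (Ds n * Ds n.+1)
                   - 4^-1 *: (Cs n.+1 ^+ 2 - Cs 0%N ^+ 2)
                   - 2^-1 *: (Phi * ((Cs n.+1)^`() - (Cs 0%N)^`())))
        + 2^-1 *: ((Cs n.+1 - Cs 0%N) * Phi * (Ds n.+1)^`()))
       (P n.+1).
Proof.
move=> Cs Ds h1 h2 m01 m12 m02; rewrite /ode2.
have [str _] := structure_relations R P beta gamma Phi C D hrec n.
have ord2 := second_order_relation R P beta gamma Phi C D n hrec.
rewrite /= -/Cs -/Ds -/m12 -/m02 -/h2 in str ord2.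
have str1 : Phi * (P n.+1)^`() + m01 * P n.+1 = h1 * P n.
  by rewrite str /m01 /h1 /M01 /H1 -!mul_polyC; ring.
have odeI : Phi ^+ 2 * h1 * (P n.+1)^`(2)
    + (m12 * h1 - Phi * h2) * (P n.+1)^`()
    + (m02 * h1 - m01 * h2) * P n.+1 = 0.
  transitivity (h1 * (h2 * P n) - h2 * (h1 * P n)); last by ring.
  by rewrite -ord2 -str1; ring.
split=> //.
have [_ _ _ gamma_neq0 _] := hrec.
apply/eqP; rewrite -(inj_eq (scalerI (gamma_neq0 n))) scaler0.
rewrite -oppr_eq0 -odeI; apply/eqP.
(* The undifferentiated C terms of (I) are the half-sum s and the half-difference d; those of (II)
   match them through C_0 = s - d and (C_(n+1)^2 - C_0^2)/4 = d s. *)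
have C0_halves : Cs 0%N = 2^-1 *: (Cs n.+1 + Cs 0%N) - 2^-1 *: (Cs n.+1 - Cs 0%N).
  by rewrite -scalerBr opprB addrC addrA subrK halfD_self.
have diff_sqr : 4^-1 *: (Cs n.+1 ^+ 2 - Cs 0%N ^+ 2)
    = 2^-1 *: (Cs n.+1 - Cs 0%N) * (2^-1 *: (Cs n.+1 + Cs 0%N)).
  by rewrite -scalerAl -scalerAr scalerA -invfM -natrM subr_sqr.
rewrite diff_sqr [Phi^`() + Cs 0%N]addrC [X in X + Phi^`()]C0_halves.
rewrite /m12 /m02 /h1 /h2 /m01 /M12 /M02 /H1 /H2 /M01 derivN derivZ derivB.
rewrite -!mul_polyC; ring.
Qed.
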